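(* Let $k\ge1$ and $n$ be positive integers. Let $\Gamma(m)$ denote the least common multiple of $1,2,\dots,m$, and define $m_1=m_2=1$, $m_3=2$ and $m_{i+1}=2m_i(m_i-1)\Gamma(2m_i-1)$ for $i\ge3$. If $4m_{2k}$ divides $n$, then for any set $\{F_1,\dots,F_k\}$ of binary frequency squares of order $n$ (not necessarily pairwise orthogonal), there exists a binary frequency square $F$ of order $n$ that is orthogonal to every $F_i$, $1\le i\le k$.
   Context: A binary frequency square of order $n$ ($n$ even) is an $n\times n$ array with entries in $\{0,1\}$ in which each row and each column contains exactly $n/2$ zeros and $n/2$ ones. Two binary frequency squares of order $n$ are orthogonal if, when superimposed, each of the ordered pairs $(0,0),(0,1),(1,0),(1,1)$ occurs exactly $n^2/4$ times. *)

(* Defs.v *)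
From mathcomp Require Import all_boot all_algebra.
Set Implicit Arguments.
Unset Strict Implicit.
Unset Printing Implicit Defensive.

(* The symbols 0 and 1 are represented by false and true. *)
Definition binary_freq_square (n : nat) (F : 'M[bool]_n) : Prop :=
  [/\ ~~ odd n,
      forall (i : 'I_n) (a : bool), #|[set j : 'I_n | F i j == a]| = n %/ 2
    & forall (j : 'I_n) (a : bool), #|[set i : 'I_n | F i j == a]| = n %/ 2].

(* The division is exact for frequency squares, since their order is even. *)
Definition fs_orthogonal (n : nat) (F G : 'M[bool]_n) : Prop :=
  forall a b : bool,
    #|[set p : 'I_n * 'I_n | (F p.1 p.2, G p.1 p.2) == (a, b)]| = n ^ 2 %/ 4.

Definition Gamma (m : nat) : nat := \big[lcmn/1]_(1 <= i < m.+1) i.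

(* The sequence is indexed from 1; the value at 0 is irrelevant. *)
Fixpoint mseq (i : nat) : nat :=
  match i with
  | 0 | 1 | 2 => 1
  | 3 => 2
  | j.+1 => 2 * mseq j * (mseq j - 1) * Gamma (2 * mseq j - 1)
  end.

(* Main.v *)
Require Import Defs.
From mathcomp Require Import all_boot all_order all_algebra zify.
Set Implicit Arguments.
Unset Strict Implicit.
Unset Printing Implicit Defensive.
Import Order.TTheory GRing.Theory Num.Theory.

(* Pair up the rows of the array, and let the two rows of F in a pair be the
   indicator of a set S of columns and its complement. Then all columns of F are
   balanced, and it suffices that S contains half of the columns and exactly half
   of the ones in each of the 2k rows of F_1, ..., F_k met by the pair. So every
   family of n columns balanced with respect to d = 2k binary coordinates has to be
   halved in a balanced way; this is possible because it splits into blocks of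
   size 2 m_d, each balanced, and their number is even as 4 m_d divides n.

   Such a splitting is built by induction on d, starting for d = 2 from pairs of
   complementary columns. Blocks of size 2m balanced in d
   coordinates carry a weight in [-m, m], their excess of ones in coordinate d+1,
   and the weights sum to zero. A nonempty zero-sum sequence of integers in [-m, m]
   contains a nonempty zero-sum subsequence of length at most L = max(2, 2m-1).
   With G = Gamma(L), among zero-sum pieces of length at most L and total length at
   least L G some length l occurs at least G / l times, which gives a zero-sum
   piece of length exactly G. Removing such pieces as long as L G or more terms are
   left ends with a zero-sum piece of length (L-1) G, whence
   m_{d+1} = m (L-1) G. *)

(** * Splitting a sequence into pieces, up to permutation *)

(** Every step removes a nonempty piece satisfying [Q] and preserves the invariant [P], so induction
    on the size applies. *)
Lemma decompose (T : eqType) (P Q : seq T -> Prop) :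
  (forall s, P s -> s != [::] ->
     exists b r, [/\ perm_eq s (b ++ r), b != [::], Q b & P r]) ->
  forall s, P s ->
    exists ss, perm_eq s (flatten ss) /\ forall b, b \in ss -> Q b.
Proof.
move=> step s; move: {2}(size s) (leqnn (size s)) => N.
elim: N s => [|N IH] s leN Ps.
  by exists [::]; split=> //=; rewrite leqn0 size_eq0 in leN; rewrite (eqP leN).
have [->|s0] := eqVneq s [::]; first by exists [::].
have [b [r [sbr b0 Qb Pr]]] := step s Ps s0.
have [|ss [rss Qss]] := IH r _ Pr.
  by move: (perm_size sbr) b0 leN; rewrite size_cat -size_eq0; lia.
exists (b :: ss); split=> [|c]; first by rewrite (perm_trans sbr) //= perm_cat2l.
by rewrite inE => /predU1P[->|/Qss].
Qed.

(** * Short zero-sum subsequences of bounded integers *)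

Section ZeroSum.
Variables (T : eqType) (w : T -> int).
Local Open Scope ring_scope.

Definition wsum (s : seq T) : int := \sum_(x <- s) w x.

Lemma wsum_cat s t : wsum (s ++ t) = wsum s + wsum t.
Proof. exact: big_cat. Qed.

Lemma wsum_perm s t : perm_eq s t -> wsum s = wsum t.
Proof. exact: perm_big. Qed.

Lemma wsum_flatten ss :
  (forall b, b \in ss -> wsum b = 0) -> wsum (flatten ss) = 0.
Proof.
elim: ss => [|b ss IH] H /=; first exact: big_nil.
by rewrite wsum_cat H ?mem_head // IH // => c css; apply: H; rewrite inE css orbT.
Qed.

Lemma wsum_ge0_mem s : s != [::] -> 0 <= wsum s -> exists2 x, x \in s & 0 <= w x.
Proof.
case: s => // x0 s _ H; case: (boolP (has (fun x => 0 <= w x) (x0 :: s))).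
  by case/hasP=> x; exists x.
rewrite -all_predC => /allP A; suff: wsum (x0 :: s) < 0 by rewrite ltNge H.
rewrite /wsum big_cons ltr_wnDr //; last by have /= := A x0 (mem_head _ _); lia.
rewrite big_seq; apply: sumr_le0 => x xs.
by have /= := A x; rewrite inE xs orbT => /(_ isT); lia.
Qed.

Lemma wsum_lt0_mem s : wsum s < 0 -> exists2 x, x \in s & w x < 0.
Proof.
move=> H; case: (boolP (has (fun x => w x < 0) s)); first by case/hasP=> x; exists x.
rewrite -all_predC => /allP A; suff: 0 <= wsum s by rewrite leNgt H.
by rewrite /wsum big_seq; apply: sumr_ge0 => x /A /=; lia.
Qed.

(* Greedy reordering: append a negative term exactly when the running sum is
   positive. *)
Lemma bounded_prefix_sums (m : nat) (s : seq T) (e : int) :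
  (forall x, x \in s -> - m%:Z <= w x < m%:Z) -> e + wsum s = 0 -> `|e| < m%:Z ->
  exists2 t, perm_eq s t & forall i, `|e + wsum (take i t)| < m%:Z.
Proof.
move: {2}(size s) (erefl (size s)) => N; elim: N s e => [|N IH] s e sN sw es em.
  exists s => // i; move/eqP: sN; rewrite size_eq0 => /eqP ->.
  by rewrite /wsum big_nil addr0.
have [x xs ex] : exists2 x, x \in s & `|e + w x| < m%:Z.
  case: (lerP e 0) => e0.
    have [||x xs wx] := @wsum_ge0_mem s; [by rewrite -size_eq0 sN|lia|].
    by exists x => //; have := sw x xs; lia.
  have [|x xs wx] := @wsum_lt0_mem s; first lia.
  by exists x => //; have := sw x xs; lia.
have px := perm_to_rem xs.
have [||||t pt ht] := IH (rem x s) (e + w x); rewrite ?size_rem ?sN //.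
- by move=> y /mem_rem; apply: sw.
- by rewrite -es (wsum_perm px) /wsum big_cons addrA.
exists (x :: t); first by rewrite (perm_trans px) // perm_cons.
case=> [|i] /=; first by rewrite /wsum big_nil addr0.
by rewrite /wsum big_cons addrA; apply: ht.
Qed.

(* There are only 2m-1 possible values for the prefix sums of the reordering, so
   two of the first 2m prefix sums agree. *)
Lemma short_zero_sum_lt (m : nat) (s : seq T) : (0 < m)%N -> s != [::] ->
  (forall x, x \in s -> - m%:Z <= w x < m%:Z) -> wsum s = 0 ->
  exists b r, [/\ perm_eq s (b ++ r), (0 < size b <= 2 * m - 1)%N & wsum b = 0].
Proof.
move=> m0 s0 sw es; case: (leqP (size s) (2 * m - 1)) => hs.
  exists s, [::]; rewrite cats0; split=> //.
  by rewrite hs andbT lt0n size_eq0.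
have [||t pt ht] := @bounded_prefix_sums m s 0 sw; [lia|lia|].
have tsz : size t = size s by rewrite (perm_size pt).
(* The shift by [m - 1] moves the values strictly between [-m] and [m] onto the naturals below
   [2 * m - 1]. *)
pose P i := absz (wsum (take i t) + (m%:Z - 1)).
have : ~~ uniq (map P (iota 0 (2 * m))).
  apply/negP=> U; have := @uniq_leq_size _ _ (iota 0 (2 * m - 1)) U.
  rewrite size_map !size_iota => H; suff: (2 * m <= 2 * m - 1)%N by lia.
  apply: H => _ /mapP[i _ ->]; rewrite mem_iota /P.
  by have := ht i; lia.
move/(uniqPn 0%N) => [a [b [ab]]]; rewrite size_map size_iota => b2.
rewrite !(nth_map 0%N) ?size_iota ?nth_iota ?(ltn_trans ab b2) // !add0n => E.
have {}E : wsum (take a t) = wsum (take b t).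
  by move: E (ht a) (ht b); rewrite /P; lia.
pose u := take a t; pose v := drop a (take b t).
have uv : take b t = u ++ v.
  by rewrite /u /v -[LHS](cat_take_drop a) -take_min (minn_idPl (ltnW ab)).
exists v, (u ++ drop b t); split.
- rewrite (perm_trans pt) // -{1}[t](cat_take_drop b) uv.
  by rewrite perm_sym perm_catCA catA.
- by rewrite /v size_drop size_take; case: ifP; lia.
- by move: E; rewrite uv wsum_cat -/u; lia.
Qed.

End ZeroSum.

Lemma wsumN (T : eqType) (w : T -> int) s :
  wsum (fun x => - w x)%R s = (- wsum w s)%R.
Proof. exact: sumrN. Qed.

Section ShortZeroSum.
Local Open Scope ring_scope.

(* If both m and -m occur, they form a zero-sum pair; otherwise, up to a sign
   change, m does not occur. *)
Lemma short_zero_sum (T : eqType) (w : T -> int) (m : nat) (s : seq T) :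
  (0 < m)%N -> s != [::] ->
  (forall x, x \in s -> `|w x| <= m%:Z) -> wsum w s = 0 ->
  exists b r,
    [/\ perm_eq s (b ++ r), (0 < size b <= maxn 2 (2 * m - 1))%N & wsum w b = 0].
Proof.
move=> m0 s0 sw es.
case: (boolP (has (fun x => w x == m%:Z) s)) => [/hasP[x xs /eqP wx]|]; last first.
  rewrite -all_predC => /allP A.
  have [|b [r [p sb wb]]] := @short_zero_sum_lt T w m s m0 s0 _ es.
    by move=> x xs; have := A x xs; have := sw x xs => /=; lia.
  by exists b, r; split=> //; lia.
case: (boolP (has (fun x => w x == - m%:Z) s)) => [/hasP[y ys /eqP wy]|]; last first.
  rewrite -all_predC => /allP A.
  have [||b [r [p sb wb]]] := @short_zero_sum_lt T (fun x => - w x) m s m0 s0.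
  - by move=> z zs; have := A z zs; have := sw z zs => /=; lia.
  - by rewrite wsumN es oppr0.
  by exists b, r; split=> //; [lia|move: wb; rewrite wsumN; lia].
have yr : y \in rem x s.
  have := ys; rewrite (perm_mem (perm_to_rem xs)) inE => /predU1P[yx|//].
  by move: wy wx; rewrite yx; lia.
exists [:: x; y], (rem y (rem x s)); split; last 1 first.
- by rewrite /wsum !big_cons big_nil wx wy; lia.
- by rewrite (perm_trans (perm_to_rem xs)) //= perm_cons perm_to_rem.
- by rewrite /=; lia.
Qed.

End ShortZeroSum.

(** * Zero-sum subsequences of prescribed length *)

Lemma size_flatten_const (T : eqType) (n : nat) (ss : seq (seq T)) :
  (forall b, b \in ss -> size b = n) -> size (flatten ss) = size ss * n.
Proof.
elim: ss => //= b ss IH h; rewrite size_cat h ?mem_head // IH ?mulSn // => c css.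
by apply: h; rewrite inE css orbT.
Qed.

(** The pieces of length [l] have total length [l] times their number. Were all [L] of these
    products below [G], their sum would be below [L * G]. *)
Lemma popular_size (T : eqType) (L G : nat) (ss : seq (seq T)) : 0 < G ->
  (forall b, b \in ss -> 0 < size b <= L) -> 0 < L -> L * G <= size (flatten ss) ->
  exists2 l, 0 < l <= L & G <= l * count (fun b => size b == l) ss.
Proof.
move=> G0 hs L0 LG.
case: (boolP [exists l : 'I_L, G <= l.+1 * count (fun b => size b == l.+1) ss]).
  by case/existsP=> l; exists l.+1 => //; have := ltn_ord l; lia.
rewrite negb_exists => /forallP A.
have E : size (flatten ss) = \sum_(l < L) l.+1 * count (fun b => size b == l.+1) ss.
  rewrite size_flatten sumnE big_map big_seq.
  under [RHS]eq_bigr do rewrite -sum1_count big_distrr /= big_seq_cond big_mkcondr /=.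
  rewrite exchange_big /=; apply: eq_bigr => b /hs sb.
  (* The index [l] stands for length [l.+1], so [b] contributes only at [(size b).-1]. *)
  have lb : (size b).-1 < L by lia.
  rewrite (bigD1 (Ordinal lb)) //= prednK; last lia.
  rewrite eqxx muln1 big1 ?addn0 // => i /eqP ne.
  by case: eqP => // sbi; case: ne; apply/val_inj => /=; lia.
suff: size (flatten ss) <= L * G.-1 by move: LG; nia.
rewrite E -[L in L * _]card_ord -sum_nat_const; apply: leq_sum => l _.
by have := A l; lia.
Qed.

Lemma dvdn_Gamma l m : 0 < l <= m -> l %| Gamma m.
Proof.
move=> lm; have li : l \in index_iota 1 m.+1 by rewrite mem_index_iota; lia.
by rewrite /Gamma (big_rem _ li) /= dvdn_lcml.
Qed.

Lemma Gamma_gt0 m : 0 < Gamma m.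
Proof.
rewrite /Gamma big_seq; elim/big_ind: _ => // [x y x0 y0|i].
  by rewrite lcmn_gt0 x0.
by rewrite mem_index_iota; lia.
Qed.

Section ZeroSumOfGivenLength.
Variables (T : eqType) (w : T -> int) (m : nat).
Hypothesis m0 : 0 < m.
Let L := maxn 2 (2 * m - 1).
Let G := Gamma L.
Let bounded (s : seq T) := forall x, x \in s -> (`|w x| <= m%:Z)%R.

Lemma zero_sum_Gamma (s : seq T) : bounded s -> wsum w s = 0%R ->
  L * G <= size s ->
  exists b r, [/\ perm_eq s (b ++ r), size b = G & wsum w b = 0%R].
Proof.
move=> bs ws sz.
have [|//|ss [pss hss]] := @decompose T
    (fun s => bounded s /\ wsum w s = 0%R)
    (fun b => 0 < size b <= L /\ wsum w b = 0%R) _ s.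
  move=> t [bt wt] t0.
  have [b [r [p sb wb]]] := short_zero_sum m0 t0 bt wt.
  exists b, r; split=> //; first by rewrite -size_eq0; lia.
  split; first by move=> x xr; apply: bt; rewrite (perm_mem p) mem_cat xr orbT.
  by move: wt; rewrite (wsum_perm w p) wsum_cat wb add0r.
have [|||l lL hl] := @popular_size T L G ss (Gamma_gt0 L).
- by move=> b /hss[].
- by rewrite /L; lia.
- by rewrite -(perm_size pss).
have lG : l %| G by exact: dvdn_Gamma.
set f := (fun b : seq T => size b == l) in hl.
pose c := take (G %/ l) (filter f ss).
have cP b : b \in c -> size b = l /\ wsum w b = 0%R.
  by move=> /mem_take; rewrite mem_filter => /andP[/eqP -> /hss[]].
exists (flatten c), (flatten (drop (G %/ l) (filter f ss) ++ filter (predC f) ss)).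
split; last 1 first.
- by apply: wsum_flatten => b /cP[].
- rewrite (perm_trans pss) // -flatten_cat catA cat_take_drop.
  by apply: perm_flatten; rewrite perm_sym perm_filterC.
rewrite (@size_flatten_const _ l); last by move=> b /cP[].
rewrite size_takel ?size_filter; first by rewrite divnK.
by rewrite leq_divLR // mulnC.
Qed.

(** Zero-sum pieces of length [G] are split off until exactly [L.-1 * G] terms are left; this
    remainder is the piece returned. *)
Lemma zero_sum_extract (s : seq T) : bounded s -> wsum w s = 0%R ->
  G %| size s -> L.-1 * G <= size s ->
  exists b r, [/\ perm_eq s (b ++ r), size b = L.-1 * G & wsum w b = 0%R].
Proof.
have G0 : 0 < G := Gamma_gt0 L.
have L2 : 1 < L by rewrite /L; lia.
move=> bs ws /dvdnP[q]; elim: q s bs ws => [|q IH] s bs ws sz hs.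
  by move: hs; rewrite sz; nia.
have [qL|qL] := leqP q.+1 L.-1.
  by exists s, [::]; rewrite cats0; split=> //; nia.
have [|b [r [p sb wb]]] := zero_sum_Gamma bs ws; first by rewrite sz; nia.
have := perm_size p; rewrite size_cat => szr.
have [||||b' [r' [p' sb' wb']]] := IH r.
- by move=> x xr; apply: bs; rewrite (perm_mem p) mem_cat xr orbT.
- by move: ws; rewrite (wsum_perm w p) wsum_cat wb add0r.
- by nia.
- by nia.
exists b', (b ++ r'); split=> //.
by rewrite (perm_trans p) // perm_sym perm_catCA perm_cat2l perm_sym.
Qed.

End ZeroSumOfGivenLength.

(** * Extracting balanced blocks and halving balanced families *)

Section Balanced.
Variables (T : eqType) (f : nat -> pred T).

Definition balanced (d : nat) (s : seq T) :=
  forall j, j < d -> 2 * count (f j) s = size s.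

Lemma balanced_perm d s t : perm_eq s t -> balanced d s -> balanced d t.
Proof. by move=> p h j jd; rewrite -(perm_size p) -(permP p) h. Qed.

Lemma balanced_rest d s b r :
  perm_eq s (b ++ r) -> balanced d s -> balanced d b -> balanced d r.
Proof.
move=> p /(balanced_perm p) hs hb j jd.
by move: (hs j jd) (hb j jd); rewrite count_cat size_cat; lia.
Qed.

Lemma balanced_flatten d ss :
  (forall b, b \in ss -> balanced d b) -> balanced d (flatten ss).
Proof.
elim: ss => [|b ss IH] h j jd //=; rewrite count_cat size_cat mulnDr.
by rewrite h ?mem_head // IH // => c css; apply: h; rewrite inE css orbT.
Qed.

(** Divisibility by [2 * m] and balance both pass to the remainder, so extraction can be
    iterated. *)
Definition extractable (d m : nat) := forall s,
  balanced d s -> 2 * m %| size s -> s != [::] ->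
  exists b r, [/\ perm_eq s (b ++ r), size b = 2 * m & balanced d b].

Lemma extractable_decompose d m s : 0 < m -> extractable d m ->
  balanced d s -> 2 * m %| size s ->
  exists ss, perm_eq s (flatten ss) /\
    forall b, b \in ss -> size b = 2 * m /\ balanced d b.
Proof.
move=> m0 ext bs ds.
apply: (@decompose T (fun s => balanced d s /\ 2 * m %| size s)) => // t.
case=> bt dt t0; have [b [r [p sb bb]]] := ext t bt dt t0.
exists b, r; split=> //; first by rewrite -size_eq0; lia.
split; first exact: balanced_rest p bt bb.
by move: dt; rewrite (perm_size p) size_cat sb dvdn_addr.
Qed.

(* Balance of the first two coordinates forces the counts of the patterns
   [(a, b)] and [(~~ a, ~~ b)] to agree. *)
Lemma extractable2 : extractable 2 1.
Proof.
move=> s bs _; case: s bs => // x s bs _.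
have [y ys /andP[y0 y1]] :
    exists2 y, y \in x :: s & (f 0 y == ~~ f 0 x) && (f 1 y == ~~ f 1 x).
  apply/hasP; rewrite has_count.
  pose c (a b : bool) := count (fun y => (f 0 y == a) && (f 1 y == b)) (x :: s).
  have c0 : count (f 0) (x :: s) = c true true + c true false.
    rewrite /c; elim: (x :: s) => //= z t ->.
    by case: (f 0 z); case: (f 1 z) => /=; lia.
  have c1 : count (f 1) (x :: s) = c true true + c false true.
    rewrite /c; elim: (x :: s) => //= z t ->.
    by case: (f 0 z); case: (f 1 z) => /=; lia.
  have sz : size (x :: s) = c true true + c true false + c false true + c false false.
    rewrite /c; elim: (x :: s) => //= z t ->.
    by case: (f 0 z); case: (f 1 z) => /=; lia.
  have : 0 < c (f 0 x) (f 1 x) by rewrite /c /= !eqxx.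
  move: (bs 0 isT) (bs 1 isT); rewrite c0 c1 sz -/(c (~~ f 0 x) (~~ f 1 x)).
  clearbody c.
  by case: (f 0 x); case: (f 1 x) => /=; lia.
have yx : y \in s.
  by move: ys y0; rewrite inE => /predU1P[->|//]; case: (f 0 x).
exists [:: x; y], (rem y s); split=> //; first by rewrite /= perm_cons perm_to_rem.
by case=> [|[|//]] _ /=; [rewrite (eqP y0)|rewrite (eqP y1)]; case: (f _ x).
Qed.

(** Whole blocks serve as the terms of a zero-sum problem: coordinates below [d] are balanced in
    every block, and zero total weight balances coordinate [d]. *)
Lemma extractableS d m : 0 < m -> extractable d m ->
  let L := maxn 2 (2 * m - 1) in extractable d.+1 (m * (L.-1 * Gamma L)).
Proof.
move=> m0 ext L s bs ds s0; have G0 := Gamma_gt0 L.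
have L2 : 1 < L by rewrite /L; lia.
have [||ss [pss hss]] := @extractable_decompose d m s m0 ext.
- by move=> j jd; apply: bs; lia.
- by apply: dvdn_trans ds; rewrite mulnA dvdn_mulr.
have szs : size s = size ss * (2 * m).
  by rewrite (perm_size pss); apply: size_flatten_const => b /hss[].
have dss : L.-1 * Gamma L %| size ss.
  by move: ds; rewrite szs mulnA mulnC dvdn_pmul2r //; lia.
pose w (b : seq T) : int := ((count (f d) b)%:Z - m%:Z)%R.
have wE bb : wsum w bb = ((count (f d) (flatten bb))%:Z - (size bb * m)%:Z)%R.
  elim: bb => [|b bb IH] /=; first by rewrite /wsum big_nil.
  by rewrite /wsum big_cons -/(wsum _ _) IH /w count_cat mulSn !PoszD opprD addrACA.
have [||||B [R [pB sB wB]]] := @zero_sum_extract _ w m m0 ss.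
- move=> b /hss[sb _]; have := count_size (f d) b; rewrite sb /w; lia.
- have /eqP := bs d (leqnn _); rewrite szs mulnCA eqn_pmul2l // => /eqP bd.
  by rewrite wE -(permP pss) bd subrr.
- by apply: dvdn_trans dss; rewrite dvdn_mull.
(* As [s] is nonempty, the number of blocks is a positive multiple of [L.-1 * Gamma L]. *)
- apply: dvdn_leq => //; rewrite lt0n; apply: contraNneq s0 => ss0.
  by rewrite -size_eq0 szs ss0.
have hB b : b \in B -> size b = 2 * m /\ balanced d b.
  by move=> bB; apply: hss; rewrite (perm_mem pB) mem_cat bB.
have sfB : size (flatten B) = size B * (2 * m).
  by apply: size_flatten_const => b /hB[].
exists (flatten B), (flatten R); split.
- by rewrite (perm_trans pss) // -flatten_cat perm_flatten.
- by rewrite sfB sB -/L; nia.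
move=> j; rewrite ltnS leq_eqVlt => /predU1P[->|jd].
  by move: wB; rewrite wE sfB; lia.
by apply: balanced_flatten jd => b /hB[].
Qed.

Lemma extractable_mseq d : 2 <= d -> 0 < mseq d /\ extractable d (mseq d).
Proof.
have mS e : mseq e.+4 =
    2 * mseq e.+3 * (mseq e.+3 - 1) * Gamma (2 * mseq e.+3 - 1) by [].
elim: d => // d IH; rewrite leq_eqVlt => /predU1P[<-|d2].
  by split=> //; exact: extractable2.
have [m0 ext] := IH d2; have := extractableS m0 ext.
(* The maximum is 2 only for [d = 2], which yields the exceptional value 2 at index 3; afterwards
   [L = 2 * m - 1] and [L.-1 = 2 * (m - 1)]. *)
have -> : mseq d.+1 =
    mseq d * ((maxn 2 (2 * mseq d - 1)).-1 * Gamma (maxn 2 (2 * mseq d - 1))).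
  case: d d2 {IH m0 ext} => [|[|[|d]]] // _.
    by rewrite /= /Gamma /index_iota /= !big_cons big_nil.
  have m2 : 1 < mseq d.+3.
    elim: d => // d IHd; have G0 := Gamma_gt0 (2 * mseq d.+3 - 1).
    by rewrite mS; nia.
  rewrite mS; have -> : maxn 2 (2 * mseq d.+3 - 1) = 2 * mseq d.+3 - 1 by lia.
  by rewrite mulnA; congr (_ * _); nia.
split=> //; rewrite !muln_gt0 m0 Gamma_gt0 andbT /=; lia.
Qed.

Lemma balanced_half d s : 2 <= d -> balanced d s -> 4 * mseq d %| size s ->
  exists b r, [/\ perm_eq s (b ++ r), 2 * size b = size s & balanced d b].
Proof.
move=> d2 bs /dvdnP[q sq]; have [m0 ext] := extractable_mseq d2.
have [|ss [pss hss]] := extractable_decompose m0 ext bs.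
  by rewrite sq dvdn_mull // dvdn_mul.
have szs : size s = size ss * (2 * mseq d).
  by rewrite (perm_size pss); apply: size_flatten_const => b /hss[].
have hb b : b \in take q ss -> size b = 2 * mseq d /\ balanced d b.
  by move/mem_take/hss.
have sss : size ss = 2 * q by move: szs; rewrite sq; nia.
exists (flatten (take q ss)), (flatten (drop q ss)); split.
- by rewrite -flatten_cat cat_take_drop.
- rewrite (@size_flatten_const _ (2 * mseq d)); last by move=> b /hb[].
  by rewrite size_takel; nia.
by apply: balanced_flatten => b /hb[].
Qed.

End Balanced.

(** * Construction of the orthogonal square *)

Lemma count_enum_card (T : finType) (p : pred T) :
  count p (enum T) = #|[set x | p x]|.
Proof. by rewrite cardsE -sum1_card -sum1_count big_enum_cond. Qed.

Lemma card_set_count (T : finType) (b : seq T) (p : pred T) : uniq b ->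
  #|[set x in b | p x]| = count p b.
Proof.
move=> ub; rewrite -size_filter -(card_uniqP (filter_uniq p ub)).
by apply: eq_card => x; rewrite !inE mem_filter andbC.
Qed.

Lemma freq_square_row (n : nat) (F : 'M[bool]_n) (r : 'I_n) :
  binary_freq_square F -> 2 * #|[set j | F r j]| = n.
Proof.
case=> on hr _; have := hr r true; under eq_finset do rewrite eqb_id.
by move=> ->; lia.
Qed.

Lemma row_pair_half (k n : nat) (Fs : 'I_k -> 'M[bool]_n) (r r' : 'I_n) :
  0 < k -> 4 * mseq (2 * k) %| n ->
  (forall i, binary_freq_square (Fs i)) ->
  exists S : {set 'I_n}, 2 * #|S| = n /\
    forall i, 4 * #|[set j in S | Fs i r j]| = n /\
              4 * #|[set j in S | Fs i r' j]| = n.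
Proof.
case: k Fs => // k Fs _ dn hFs.
(* Coordinates [2i] and [2i+1] of a column are its entries in rows [r] and [r'] of the square with
   index [i]. *)
pose f (t : nat) : pred 'I_n :=
  fun j => Fs (inord t./2) (if odd t then r' else r) j.
have [|||b [c [p sb bb]]] := @balanced_half _ f (2 * k.+1) (enum 'I_n).
- by lia.
- by move=> t _; rewrite count_enum_card size_enum_ord freq_square_row.
- by rewrite size_enum_ord.
rewrite size_enum_ord in sb.
have ub : uniq b.
  by have := enum_uniq 'I_n; rewrite (perm_uniq p) cat_uniq => /andP[].
exists [set j in b]; split; first by rewrite cardsE (card_uniqP ub).
have cE (g : pred 'I_n) : #|[set j in [set j in b] | g j]| = count g b.
  by rewrite -(card_set_count g ub); apply: eq_card => x; rewrite !inE.
move=> i; rewrite !cE; have ik := ltn_ord i; split.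
  have f0 : f i.*2 =1 Fs i r by move=> j; rewrite /f odd_double doubleK inord_val.
  by rewrite -(eq_count f0) -[RHS]sb -(bb i.*2) ?mulnA; last lia.
have f1 : f i.*2.+1 =1 Fs i r'.
  by move=> j; rewrite /f /= odd_double uphalf_double inord_val.
by rewrite -(eq_count f1) -[RHS]sb -(bb i.*2.+1) ?mulnA; last lia.
Qed.

(** Two halves meeting in a quarter determine the other three cells by subtraction. *)
Lemma quarter_cells (T : finType) (q : nat) (A B : pred T) :
  #|T| = 4 * q -> 2 * #|[set x | A x]| = 4 * q -> 2 * #|[set x | B x]| = 4 * q ->
  4 * #|[set x | A x && B x]| = 4 * q ->
  forall a b : bool, #|[set x | (A x, B x) == (a, b)]| = q.
Proof.
move=> cT cA cB cAB.
pose c a b := #|[set x | (A x, B x) == (a, b)]|.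
have e0 : #|[set x | A x && B x]| = c true true.
  by apply: eq_card => x; rewrite !inE xpair_eqE !eqb_id.
have split_card (P : pred T) (g : pred T) :
    #|[set x | P x]| = #|[set x | P x && g x]| + #|[set x | P x && ~~ g x]|.
  rewrite -!count_enum_card; elim: (enum T) => //= x s ->.
  by case: (P x); case: (g x) => /=; lia.
have e1 : #|[set x | A x]| = c true true + c true false.
  rewrite (split_card A B) e0; congr (_ + _).
  by apply: eq_card => x; rewrite !inE xpair_eqE eqb_id eqbF_neg.
have e2 : #|[set x | B x]| = c true true + c false true.
  rewrite (split_card B A); congr (_ + _); apply: eq_card => x;
  by rewrite !inE xpair_eqE ?eqbF_neg ?eqb_id andbC.
have e3 : #|T| = #|[set x | A x]| + c false true + c false false.
  rewrite -cardsT -addnA.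
  have -> : [set: T] = [set x | true] by apply/setP=> x; rewrite !inE.
  rewrite (split_card predT A) /=; congr (_ + _).
  rewrite (split_card (fun x => ~~ A x) B); congr (_ + _); apply: eq_card => x;
  by rewrite !inE xpair_eqE ?eqbF_neg ?eqb_id.
by case=> [] []; rewrite -/(c _ _); lia.
Qed.

Theorem theorem3p2 (k n : nat) (hk : 1 <= k) (hn : 0 < n)
    (hdiv : 4 * mseq (2 * k) %| n)
    (Fs : 'I_k -> 'M[bool]_n)
    (hFs : forall i : 'I_k, binary_freq_square (Fs i)) :
  exists F : 'M[bool]_n,
    binary_freq_square F /\ forall i : 'I_k, fs_orthogonal F (Fs i).
Proof.
case: n hn hdiv Fs hFs => // n _ hdiv Fs hFs.
have [q nq] : exists q, n.+1 = 4 * q.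
  by case/dvdnP: hdiv => q ->; exists (q * mseq (2 * k)); rewrite mulnCA.
(* Rows [2p] and [2p+1] form pair [p]. Larger [p] give default rows, but [S] is only used at [i./2],
   where both rows exist. *)
have [S hS] := fin_all_exists (fun p : 'I_n.+1 =>
  @row_pair_half k n.+1 Fs (inord p.*2) (inord p.*2.+1) hk hdiv hFs).
pose F : 'M[bool]_n.+1 := (\matrix_(i, j) ((j \in S (inord i./2)) (+) odd i))%R.
have i2 (i : 'I_n.+1) : (inord i./2 : 'I_n.+1) = i./2 :> nat.
  by rewrite inordK //; have := ltn_ord i; lia.
have rowS (i : 'I_n.+1) : 2 * #|S (inord i./2)| = n.+1.
  by case: (hS (inord i./2)).
have rowG (i : 'I_n.+1) t : 4 * #|[set j in S (inord i./2) | Fs t i j]| = n.+1.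
  have [_ /(_ t)[]] := hS (inord i./2); rewrite i2 => h0 h1.
  have ei : inord (odd i + i./2.*2) = i by rewrite odd_double_half inord_val.
  by move: ei; case: (odd i) => ei; [rewrite ei in h1|rewrite ei in h0].
(* Orthogonality already holds row by row: each pair of symbols occurs [q] times in every row. *)
have cell (i : 'I_n.+1) t a b : #|[set j | (F i j, Fs t i j) == (a, b)]| = q.
  have := @quarter_cells _ q [pred j | j \in S (inord i./2)] (Fs t i).
  rewrite card_ord cardsE -nq => /(_ erefl (rowS i) (freq_square_row _ (hFs t))).
  rewrite /= => /(_ (rowG i t) (a (+) odd i) b) <-.
  apply: eq_card => j; rewrite !inE !xpair_eqE mxE.
  by case: (j \in _); case: a; case: (odd i).
have rowF (i : 'I_n.+1) a : #|[set j | F i j == a]| = n.+1 %/ 2.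
  (* Summing [cell] over the symbols of any one given square counts [a] in the row; [k >= 1]
     provides such a square. *)
  have t : 'I_k by exists 0.
  have -> : n.+1 %/ 2 = q + q by lia.
  rewrite -{1}(cell i t a true) -(cell i t a false) -!count_enum_card.
  elim: (enum _) => //= j s ->; rewrite !xpair_eqE.
  by case: (F i j == a); case: (Fs t i j) => /=; lia.
(* Exchanging the two rows of each pair complements [F], so it matches zeros with ones in every
   column. *)
pose sw (i : 'I_n.+1) : 'I_n.+1 := inord (if odd i then i.-1 else i.+1).
have swE (i : 'I_n.+1) : sw i = (if odd i then i.-1 else i.+1) :> nat.
  by rewrite inordK //; have := ltn_ord i; case: ifP; lia.
have swK : involutive sw.
  move=> i; apply/val_inj; rewrite /= !swE; case oi: (odd i); case: ifP; lia.
have swF i j : F (sw i) j = ~~ F i j.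
  rewrite !mxE; have -> : (sw i)./2 = i./2 by rewrite swE; case: ifP; lia.
  have -> : odd (sw i) = ~~ odd i by rewrite swE; case: ifP; lia.
  by rewrite addbN.
exists F; split; [split|move=> t a b].
- by lia.
- by [].
- move=> j a.
  have e : #|[set i | F i j == a]| = #|[set i | F i j == ~~ a]|.
    rewrite -(card_imset _ (inv_inj swK)); apply: eq_card => i.
    rewrite -[i in LHS]swK (mem_imset _ _ (inv_inj swK)) !inE swF.
    by case: (F i j); case: a.
  have := cardC [set i | F i j == a]; rewrite card_ord.
  have -> : #|[predC [set i | F i j == a]]| = #|[set i | F i j == ~~ a]|.
    by apply: eq_card => i; rewrite !inE; case: (F i j); case: a {e}.
  by rewrite -e addnn -muln2 => /(congr1 (divn^~ 2)); rewrite mulnK.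
(* Summing [cell] over the [4 * q] rows gives [4 * q * q], a quarter of the array. *)
rewrite cardsE -sum1_card.
rewrite (eq_bigl (fun p => (F p.1 p.2, Fs t p.1 p.2) == (a, b))); last first.
  by move=> p; rewrite unfold_in.
rewrite -(pair_big_dep xpredT (fun i j => (F i j, Fs t i j) == (a, b))
  (fun _ _ => 1)) /=.
under eq_bigr => i _ do rewrite sum1dep_card cell.
rewrite sum_nat_const card_ord nq; nia.
Qed.
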